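(* Let $\theta \in \mathbb{R}$ and $m, n\in \mathbb{Z}$. Let $u\in A_{\theta}$ be a unitary whose class in $K_1(A_{\theta})$ is the same as that of $U^mV^n$. Then $E(u)\ge E(U^mV^n)$, and equality holds if and only if $u$ is a scalar multiple of $U^mV^n$.
   Context: For $\theta\in\mathbb{R}$, $A_\theta$ denotes the rotation $C^*$-algebra, i.e. the universal unital $C^*$-algebra generated by two unitaries $U$ and $V$ subject to $UV=e^{2\pi i\theta}VU$. Let $\mathrm{tr}$ be the canonical faithful tracial state on $A_\theta$, determined by $\mathrm{tr}(U^mV^n)=\delta_{m,0}\delta_{n,0}$ (Kronecker deltas) for all $m,n\in\mathbb{Z}$. Let $\delta_1$ and $\delta_2$ be the canonical unbounded closed $*$-derivations of $A_\theta$, defined on dense $*$-subalgebras of $A_\theta$ and determined by $\delta_1(U)=2\pi i U$, $\delta_1(V)=0$, $\delta_2(U)=0$, $\delta_2(V)=2\pi i V$ (that is, the closures of the derivations given by these formulas on the $*$-algebra generated by $U$ and $V$). The energy of a unitary $u\in A_\theta$ is $$E(u)=\tfrac12\,\mathrm{tr}\big(\delta_1(u)^*\delta_1(u)+\delta_2(u)^*\delta_2(u)\big)$$ if $u$ belongs to the domains of both $\delta_1$ and $\delta_2$, and $E(u)=\infty$ otherwise. *)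

(* Defs.v *)
From HB Require Import structures.
From mathcomp Require Import all_boot all_order all_algebra.
From mathcomp Require Import all_classical all_reals all_analysis.
From mathcomp Require Export complex.

Set Implicit Arguments.
Unset Strict Implicit.
Unset Printing Implicit Defensive.

Import Order.TTheory GRing.Theory Num.Theory.
Import numFieldNormedType.Exports.

Local Open Scope classical_set_scope.
Local Open Scope ring_scope.

(* Unital nonzero C*-algebras over C.  As for every normedModType C, the norm
   takes its values in C (in its nonnegative reals).  The product is a field of
   the mixin because HB refuses a structure inheriting from both a normed and an
   algebra structure (their join would have to be declared before numDomainType);
   the algType C instance is declared below. *)
HB.mixin Record isCStarAlgebra (C : numClosedFieldType) A
    of CompleteNormedModule C A := {
  cs_one : A ;
  cs_mul : A -> A -> A ;
  star : A -> A ;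
  cs_mulA : associative cs_mul ;
  cs_mul1 : left_id cs_one cs_mul ;
  cs_mulr1 : right_id cs_one cs_mul ;
  cs_mulDl : left_distributive cs_mul +%R ;
  cs_mulDr : right_distributive cs_mul +%R ;
  cs_one_neq0 : cs_one != 0 ;
  cs_scaleAl : forall (c : C) (a b : A), c *: cs_mul a b = cs_mul (c *: a) b ;
  cs_scaleAr : forall (c : C) (a b : A), c *: cs_mul a b = cs_mul a (c *: b) ;
  starK : involutive star ;
  starD : {morph star : a b / a + b} ;
  starZ : forall (c : C) (a : A), star (c *: a) = c^* *: star a ;
  starM : forall a b : A, star (cs_mul a b) = cs_mul (star b) (star a) ;
  normM_le : forall a b : A, `|cs_mul a b| <= `|a| * `|b| ;
  norm_star_mul : forall a : A, `|cs_mul (star a) a| = `|a| ^+ 2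
}.

#[short(type="cstarAlgType")]
HB.structure Definition CStarAlgebra (C : numClosedFieldType) :=
  {A of CompleteNormedModule C A & isCStarAlgebra C A}.

Section CStarAlgebraRing.
Context {C : numClosedFieldType} {A : cstarAlgType C}.

#[non_forgetful_inheritance]
HB.instance Definition _ := GRing.Zmodule_isNzRing.Build A
  (@cs_mulA C A) (@cs_mul1 C A) (@cs_mulr1 C A) (@cs_mulDl C A) (@cs_mulDr C A)
  (@cs_one_neq0 C A).
#[non_forgetful_inheritance]
HB.instance Definition _ := GRing.Lmodule_isLalgebra.Build C A (@cs_scaleAl C A).
#[non_forgetful_inheritance]
HB.instance Definition _ := GRing.Lalgebra_isAlgebra.Build C A (@cs_scaleAr C A).

End CStarAlgebraRing.

Section CStarAlgebras.
Context {C : numClosedFieldType}.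
Implicit Types A B : cstarAlgType C.

Definition unitary A (u : A) : Prop := star u * u = 1 /\ u * star u = 1.

(* Integer powers of a unitary, whose inverse is its adjoint. *)
Definition upow A (u : A) (m : int) : A :=
  match m with Posz k => u ^+ k | Negz k => star u ^+ k.+1 end.

(* Unital *-homomorphisms; no continuity is required. *)
Definition star_hom A B (f : A -> B) : Prop :=
  [/\ f 1 = 1,
      forall (c : C) x y, f (c *: x + y) = c *: f x + f y,
      forall x y, f (x * y) = f x * f y &
      forall x, f (star x) = star (f x)].

(* Unital *-subalgebras, not necessarily closed. *)
Definition star_subalgebra A (D : set A) : Prop :=
  [/\ D 1,
      forall (c : C) x y, D x -> D y -> D (c *: x + y),
      forall x y, D x -> D y -> D (x * y) &
      forall x, D x -> D (star x)].

Definition star_alg A (U V : A) : set A :=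
  smallest (@star_subalgebra A) [set U; V].

Definition faithful_tracial_state A (tr : {scalar A}) : Prop :=
  [/\ forall x : A, 0 <= tr (star x * x),
      tr 1 = 1,
      forall x y : A, tr (x * y) = tr (y * x) &
      forall x : A, tr (star x * x) = 0 -> x = 0].

(* Only the values of d on D are relevant. *)
Definition star_derivation A (D : set A) (d : A -> A) : Prop :=
  [/\ star_subalgebra D,
      forall (c : C) x y, D x -> D y -> d (c *: x + y) = c *: d x + d y,
      forall x y, D x -> D y -> d (x * y) = d x * y + x * d y &
      forall x, D x -> d (star x) = star (d x)].

(* Unbounded operators on A are identified with their graphs in A * A. *)
Definition op_closure A (D : set A) (d : A -> A) : set (A * A) :=
  closure [set (x, d x) | x in D].

Definition op_domain A (T : set (A * A)) : set A :=
  [set x | exists y, T (x, y)].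

(* The value at x, for x in the domain of an operator with graph T. *)
Definition op_val A (T : set (A * A)) (x : A) : A :=
  xget 0 [set y | T (x, y)].

Definition star_mx A p q (M : 'M[A]_(p, q)) : 'M[A]_(q, p) :=
  (map_mx star M)^T.

Definition unitary_mx A p (M : 'M[A]_p) : Prop :=
  star_mx M *m M = 1%:M /\ M *m star_mx M = 1%:M.

End CStarAlgebras.

Section K1.
Context {R : realType}.
Implicit Types A : cstarAlgType R[i].

(* Homotopy in U_p(A).  The topology of 'M[A]_p is that of entrywise
   convergence, which is the topology of the C*-norm of M_p(A). *)
Definition unitary_homotopic A p (M N : 'M[A]_p) : Prop :=
  exists w : R -> 'M[A]_p,
    [/\ {within `[0, 1], continuous w},
        forall t, t \in `[0, 1] -> unitary_mx (w t),
        w 0 = M & w 1 = N].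

(* M (+) 1_k *)
Definition stab_mx A p k (M : 'M[A]_p) : 'M[A]_(p + k) :=
  block_mx M 0 0 1%:M.

Definition K1_equiv A p q (M : 'M[A]_p) (N : 'M[A]_q) : Prop :=
  exists k l, exists e : (p + k = q + l)%N,
    unitary_homotopic (castmx (e, e) (stab_mx k M)) (stab_mx l N).

(* K_1(A) is the quotient of the disjoint union U_oo(A) of the U_p(A) by
   K1_equiv; the class of M is the set of the unitaries equivalent to M. *)
Definition K1_class A p (M : 'M[A]_p) : set {q : nat & 'M[A]_q} :=
  [set N | unitary_mx (tagged N) /\ K1_equiv M (tagged N)].

Definition K1_class1 A (u : A) : set {q : nat & 'M[A]_q} :=
  K1_class (u%:M : 'M[A]_1).

End K1.

Section RotationAlgebras.
Context {R : realType}.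
Implicit Types A B : cstarAlgType R[i].

Definition two_pi_i : R[i] := (0 +i* (2 * pi))%C.

(* e^{2 pi i theta} *)
Definition rot_scalar (theta : R) : R[i] :=
  (cos (2 * pi * theta) +i* sin (2 * pi * theta))%C.

Definition rotation_relation (theta : R) A (U V : A) : Prop :=
  [/\ unitary U, unitary V & U * V = rot_scalar theta *: (V * U)].

(* A is A_theta with generators U and V.  The *-homomorphism below is unique by
   density of the *-algebra generated by U and V. *)
Definition rotation_algebra (theta : R) A (U V : A) : Prop :=
  [/\ rotation_relation theta U V,
      closure (star_alg U V) = setT &
      forall B (U' V' : B), rotation_relation theta U' V' ->
        exists f : A -> B, [/\ star_hom f, f U = U' & f V = V']].

Definition canonical_trace A (U V : A) (tr : {scalar A}) : Prop :=
  faithful_tracial_state tr /\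
  forall m n : int,
    tr (upow U m * upow V n) = ((m == 0) && (n == 0))%:R.

(* E(u), with d1 and d2 given by their graphs.  The trace below is a nonnegative
   element of R[i], hence equal to its real part. *)
Definition energy A (tr : {scalar A}) (T1 T2 : set (A * A)) (u : A) : \bar R :=
  if `[< op_domain T1 u /\ op_domain T2 u >] then
    (2^-1 * complex.Re (tr (star (op_val T1 u) * op_val T1 u
                            + star (op_val T2 u) * op_val T2 u)))%:E
  else +oo%E.

End RotationAlgebras.

(* Main.v *)
Require Import Defs.
From mathcomp Require Import all_boot all_order all_algebra.
From mathcomp Require Import all_classical all_reals all_analysis.
From mathcomp Require Import ring lra.
Import Order.TTheory GRing.Theory Num.Theory.
Import numFieldNormedType.Exports.
Local Open Scope classical_set_scope.
Local Open Scope ring_scope.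

(** The number tr (u^* delta_j(u)) is a homotopy invariant: for a unitary u in
    the domain of delta_j it depends only on the K_1 class of u, so that it can
    be read off from U^m V^n, where it is c_1 = 2 pi i m for delta_1 and
    c_2 = 2 pi i n for delta_2 ([K1_winding], [delta_winding]).  Subtracting
    from delta_j(u) its L^2 projection c_j u on the line through u, one gets

      tr (delta_j(u)^* delta_j(u)) = |c_j|^2 + tr (z_j^* z_j)
      with z_j = delta_j(u) - c_j u

    ([tr_var]).  The sum of the |c_j|^2 is twice the energy of U^m V^n, which
    gives the inequality.  Equality forces delta_j(u) = c_j u; comparing the
    Fourier coefficients tr (u (U^k V^l)^* ) of both sides, all of them vanish
    except for (k, l) = (m, n), and an element of A is determined by its Fourier
    coefficients ([fourier_inj]).

    For homotopy invariance, only u itself is known to be differentiable, while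
    the homotopy is merely continuous and takes its values in matrices.  One
    therefore attaches to each unitary matrix W the common value, called below
    its local winding, of Tr (X^-1 delta(X)) over all the differentiable X close
    to W.  It exists because X |-> Tr (X^-1 delta(X)) is additive on products
    and vanishes near 1: for small Z, expanding (1 - Z)^-1 as a geometric series
    reduces Tr ((1 - Z)^-1 delta(Z)) to the traces of Z^n delta(Z), which
    agrees up to commutators with delta(Z^(n+1)) / (n + 1), and tr o delta = 0
    ([mxtr_neumann_diff]).  Two differentiable X, Y near W are compared through
    the product X^* Y, which is near 1; in this way the inverses never have to
    be differentiable.  By construction the local winding is locally constant,
    hence constant along paths ([homotopy_winding]).

    The graph of the closure of a derivation enters only through the algebraic
    rules collected in [traceless_calculus]; that these rules pass from the
    derivation to its closure uses that tr is bounded, which is deduced from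
    positivity with the square root of 1 - h ([sqrt_one_sub], [tr_bound]). *)

(** * The norm and the involution *)

Lemma geometric_small {R : realType} (K r e : R) : 0 <= r -> r < 1 -> 0 < e ->
  exists k, forall n, (k <= n)%N -> K * r ^+ n < e.
Proof.
move=> r0 r1 e0.
have /cvgrPdist_lt/(_ e e0)[k _ kP] : geometric K r @ \oo --> (0 : R).
  by apply: cvg_geometric; rewrite ger0_norm.
exists k => n /kP; rewrite /= sub0r normrN.
exact: (le_lt_trans (ler_norm _)).
Qed.

Section RealNorm.
Context {R : realType} {A : cstarAlgType R[i]}.
Implicit Types (a b : A) (c : R[i]).

(** The norm of [A] takes its values in R[i]; all the estimates below are made
    in R. *)
Definition nrm a : R := complex.Re `|a|.

Lemma nrmE a : (nrm a)%:C%C = `|a|.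
Proof. by rewrite /nrm RRe_real // realE normr_ge0. Qed.

Lemma nrm_ge0 a : 0 <= nrm a.
Proof. by rewrite -ler0c nrmE normr_ge0. Qed.

Lemma nrm0 : nrm 0 = 0.
Proof. by rewrite /nrm normr0. Qed.

Lemma nrmD a b : nrm (a + b) <= nrm a + nrm b.
Proof. by rewrite -lecR rmorphD /= !nrmE ler_normD. Qed.

Lemma nrmN a : nrm (- a) = nrm a.
Proof. by rewrite /nrm normrN. Qed.

Lemma nrm_distC a b : nrm (a - b) = nrm (b - a).
Proof. by rewrite -nrmN opprB. Qed.

Lemma nrmM a b : nrm (a * b) <= nrm a * nrm b.
Proof. by rewrite -lecR rmorphM /= !nrmE; exact: normM_le. Qed.

Lemma nrmZ c a : nrm (c *: a) = complex.Re `|c| * nrm a.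
Proof.
by apply: complexI; rewrite nrmE normrZ rmorphM -nrmE; congr (_ * _).
Qed.

Lemma nrm_eq0 a : nrm a = 0 -> a = 0.
Proof. by move=> h; apply/normr0_eq0; rewrite -nrmE h. Qed.

Lemma nrm_le_small a : (forall e : R, 0 < e -> nrm a <= e) -> a = 0.
Proof.
move=> H; apply/nrm_eq0/eqP; rewrite eq_le nrm_ge0 andbT.
by apply/ler_addgt0Pr => e /H; rewrite add0r.
Qed.

Lemma norm_le_small c : (forall e : R, 0 < e -> complex.Re `|c| <= e) -> c = 0.
Proof.
move=> H; have c0 : complex.Re `|c| <= 0.
  by apply/ler_addgt0Pr => e /H; rewrite add0r.
apply/normr0_eq0/eqP; rewrite eq_le normr_ge0 andbT.
by rewrite -[`|c|]RRe_real ?realE ?normr_ge0// (lecR _ 0).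
Qed.

Lemma gt0_complexP c : 0 < c -> exists2 r : R, 0 < r & c = r%:C%C.
Proof.
rewrite ltcE /= => /andP[/eqP ci cr]; exists (complex.Re c) => //.
by rewrite [LHS]complexE ci mulr0 addr0.
Qed.

(** The C*-identity gives |a|^2 = |a^* a| <= |a^*| |a|. *)
Lemma nrm_star a : nrm (star a) = nrm a.
Proof.
have le1 (b : A) : nrm b <= nrm (star b).
  have [->|bn0] := eqVneq b 0; first by rewrite nrm0 nrm_ge0.
  have bgt0 : 0 < nrm b.
    rewrite lt_def nrm_ge0 andbT; apply: contra_neq bn0; exact: nrm_eq0.
  rewrite -(ler_pM2r bgt0) -expr2.
  suff -> : nrm b ^+ 2 = nrm (star b * b) by exact: nrmM.
  by apply: complexI; rewrite rmorphXn /= !nrmE norm_star_mul.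
by apply/eqP; rewrite eq_le le1 -{2}[a]starK le1.
Qed.

Lemma ball_nrmE a b (e : R) : ball a e%:C%C b = (nrm (a - b) < e) :> Prop.
Proof.
by rewrite -ball_normE /ball_ /= -nrmE ltcR.
Qed.

Lemma star0 : star (0 : A) = 0.
Proof. by apply: (addrI (star 0)); rewrite -starD !addr0. Qed.

Lemma starN a : star (- a) = - star a.
Proof. by apply: (addrI (star a)); rewrite -starD !subrr star0. Qed.

Lemma star_mul a b : star (a * b) = star b * star a.
Proof. exact: starM. Qed.

Lemma star1 : star (1 : A) = 1.
Proof. by rewrite -[LHS]mulr1 -{2}[1]starK -star_mul mulr1 starK. Qed.

(** Completeness, in the form needed for the geometric series and for fixed
    points of contractions. *)
Lemma nrm_cauchy (s : nat -> A) (K r : R) : 0 <= r -> r < 1 ->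
  (forall n, nrm (s n.+1 - s n) <= K * r ^+ n) ->
  exists l, forall e, 0 < e -> exists k, forall n, (k <= n)%N -> nrm (s n - l) < e.
Proof.
move=> r0 r1 sK.
have K0 : 0 <= K by have := sK 0; rewrite expr0 mulr1; apply: le_trans; exact: nrm_ge0.
have tail n k : nrm (s (n + k)%N - s n) <= K / (1 - r) * r ^+ n.
  suff H : nrm (s (n + k)%N - s n) * (1 - r) <= K * r ^+ n * (1 - r ^+ k).
    have r1' : 0 < 1 - r by rewrite subr_gt0.
    rewrite -(ler_pM2r r1') (le_trans H)//.
    rewrite [leRHS]mulrAC divfK ?gt_eqF// ler_piMr// ?mulr_ge0 ?exprn_ge0//.
    by rewrite lerBlDr lerDl exprn_ge0.
  elim: k => [|k IH]; first by rewrite addn0 subrr nrm0 expr0 subrr mulr0 mul0r.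
  have -> : s (n + k.+1)%N - s n = (s (n + k).+1 - s (n + k)%N) + (s (n + k)%N - s n).
    by rewrite addnS addrA subrK.
  have r1' : 0 <= 1 - r by rewrite subr_ge0 ltW.
  apply: (le_trans (ler_wpM2r r1' (nrmD _ _))); rewrite mulrDl.
  apply: (le_trans (lerD (ler_wpM2r r1' (sK _)) IH)).
  rewrite le_eqVlt; apply/orP; left; apply/eqP.
  by rewrite exprD exprS; ring.
have small e := @geometric_small R (K / (1 - r)) r e r0 r1.
have cv : cvg (s @ \oo).
  apply/cauchy_cvgP/cauchy_exP => _ /gt0_complexP[e e0 ->].
  have [k kP] := small _ e0.
  exists (s k); exists k => //= n kn.
  rewrite /preimage /mkset ball_nrmE nrm_distC -(subnKC kn).
  by apply: (le_lt_trans (tail _ _)); exact: kP.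
exists (lim (s @ \oo)) => e e0.
have /cvgrPdist_lt/(_ e%:C%C) := cv.
rewrite ltcR => /(_ e0)[k _ kP]; exists k => n /kP /=.
by rewrite -nrmE ltcR nrm_distC.
Qed.
End RealNorm.

(** * Tracial states are bounded *)

Section Trace.
Context {R : realType} {A : cstarAlgType R[i]}.
Implicit Types (a b x y z u : A) (c : R[i]).

(** With z = 1 - y the equation z^2 = 1 - h reads y = (h + y^2) / 2, whose right
    hand side is a contraction of the ball of radius |h| that commutes with the
    involution. *)
Lemma sqrt_one_sub (h : A) : star h = h -> nrm h < 1 ->
  exists z, star z = z /\ z * z = 1 - h.
Proof.
move=> hs h1; set r := nrm h.
have r0 : 0 <= r by exact: nrm_ge0.
have half a : nrm (2^-1 *: a) = 2^-1 * nrm a.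
  rewrite nrmZ ger0_norm ?invr_ge0 ?ler0n//; congr (_ * _); apply: complexI.
  by rewrite RRe_real ?fmorphV ?rmorph_nat ?rpredV ?realn.
pose F y : A := 2^-1 *: (h + y * y).
have Fle y : nrm y <= r -> nrm (F y) <= r.
  move=> yr; rewrite half; have := nrmD h (y * y); have := nrmM y y.
  have := nrm_ge0 y; rewrite -/r; move: h1; rewrite -/r; nra.
have FL y z : nrm y <= r -> nrm z <= r -> nrm (F y - F z) <= r * nrm (y - z).
  move=> yr zr; rewrite -scalerBr half.
  have -> : h + y * y - (h + z * z) = y * (y - z) + (y - z) * z.
    by rewrite mulrBr mulrBl addrA subrK opprD addrACA subrr add0r.
  have := nrmD (y * (y - z)) ((y - z) * z).
  have := nrmM y (y - z); have := nrmM (y - z) z; have := nrm_ge0 (y - z); nra.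
pose s n := iter n F 0.
have sr n : nrm (s n) <= r by elim: n => [|n IH]; rewrite /= ?nrm0// Fle.
have ss n : star (s n) = s n.
  elim: n => [|n IH] /=; first exact: star0.
  rewrite {1}/F starZ starD star_mul IH hs; congr (_ *: _).
  by rewrite fmorphV rmorph_nat.
have [|y yP] := @nrm_cauchy R A s r r r0 h1.
  elim=> [|n IH].
    by rewrite expr0 mulr1 subr0 sr.
  apply: (le_trans (FL (s n.+1) (s n) (sr _) (sr _))).
  by rewrite exprS ler_wpM2l.
have close e : 0 < e -> exists n, nrm (s n - y) < e /\ nrm (s n.+1 - y) < e.
  by move=> /yP[k kP]; exists k; split; apply: kP.
have yr : nrm y <= r.
  apply/ler_addgt0Pr => e /close[n [e1 _]].
  have := nrmD (s n) (y - s n); rewrite subrKC nrm_distC => yle.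
  by apply: (le_trans yle); rewrite lerD// ltW.
have yF : F y = y.
  apply/subr0_eq/nrm_le_small => e e0.
  have e20 : 0 < e / 2 by rewrite divr_gt0.
  have [n [e1 e2]] := close _ e20.
  have -> : F y - y = (F y - F (s n)) + (s n.+1 - y) by rewrite /= addrA subrK.
  apply: (le_trans (nrmD _ _)).
  have H1 := FL y (s n) yr (sr n); rewrite (nrm_distC y) in H1.
  have H2 : r * nrm (s n - y) <= nrm (s n - y) by rewrite ler_piMl ?nrm_ge0// ltW.
  lra.
have ys : star y = y.
  apply/subr0_eq/nrm_le_small => e e0.
  have e20 : 0 < e / 2 by rewrite divr_gt0.
  have [n [e1 _]] := close _ e20.
  have -> : star y - y = star (y - s n) + (s n - y).
    by rewrite starD starN ss addrA subrK.
  apply: (le_trans (nrmD _ _)); rewrite nrm_star (nrm_distC y).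
  lra.
exists (1 - y); split; first by rewrite starD starN star1 ys.
have hE : h = 2 *: y - y * y.
  by rewrite -{1}yF scalerA divff ?pnatr_eq0// scale1r addrK.
rewrite hE scaler_nat mulr2n mulrBl mul1r mulrBr mulr1 !opprB opprD !addrA.
by rewrite (addrAC 1).
Qed.

Context {tr : {scalar A}} (htr : faithful_tracial_state tr).

Let pos := let: And4 p _ _ _ := htr in p.
Let tr1 := let: And4 _ p _ _ := htr in p.

(** Polarization of the positivity of tr: tr ((x + c)^* (x + c)) is real for
    c = 1 and for c = i. *)
Lemma tr_star x : tr (star x) = (tr x)^*.
Proof.
have ex c : tr (star (x + c *: 1) * (x + c *: 1)) =
    tr (star x * x) + (c * tr (star x) + c^* * tr x + c^* * c).
  rewrite starD starZ star1 mulrDl !mulrDr -!scalerAr -!scalerAl !mul1r !mulr1.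
  rewrite !linearD !linearZ /= tr1 mulr1; ring.
have re c : complex.Im (c * tr (star x) + c^* * tr x + c^* * c) = 0.
  have := ger0_Im (pos (x + c *: 1)); rewrite ex raddfD /= (ger0_Im (pos x)).
  by rewrite add0r.
have := re 1; have := re 'i%C.
move: (tr x) (tr (star x)) => [a b] [c d] /=.
by simpc => /= /subr0_eq -> /eqP; rewrite addr_eq0 => /eqP ->.
Qed.

(** Pythagoras in L^2(A, tr), in which the unitary u has norm 1. *)
Lemma tr_var (u y : A) c : unitary u -> tr (star u * y) = c ->
  tr (star (y - c *: u) * (y - c *: u)) = tr (star y * y) - c^* * c.
Proof.
move=> [uu _] yc.
have cy : tr (star y * u) = c^*.
  by rewrite -yc -tr_star star_mul starK.
rewrite starD starN starZ mulrDl !mulrDr !mulrN !mulNr -!scalerAr -!scalerAl.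
rewrite !linearD !linearN !linearZ /= yc cy uu tr1 -![_ *: _ : R[i]^o]/(_ * _).
ring.
Qed.

(** Positivity of tr at the square root of 1 - h, for h = x^* x / (2 |x|)^2,
    bounds tr (x^* x) by (2 |x|)^2, and |tr x|^2 <= tr (x^* x).  The factor 2 is
    there to make |h| < 1 strict. *)
Lemma tr_bound x : complex.Re `|tr x| <= 2 * nrm x.
Proof.
have [->|x0] := eqVneq x 0; first by rewrite linear0 normr0 nrm0 mulr0.
have nx : 0 < nrm x.
  by rewrite lt_def nrm_ge0 andbT; apply: contra_neq x0; exact: nrm_eq0.
have sq : 0 <= tr (star x * x) - (tr x)^* * tr x.
  have := @tr_var 1 x (tr x); rewrite star1 mul1r => <- //.
  by split; rewrite star1 mulr1.
pose k : R := (2 * nrm x)^-1.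
have k0 : 0 < k by rewrite invr_gt0 mulr_gt0.
pose h := (k ^+ 2)%:C%C *: (star x * x).
have hs : star h = h.
  rewrite /h starZ star_mul starK; congr (_ *: _).
  exact: conjc_real.
have h1 : nrm h < 1.
  rewrite nrmZ ger0_norm; last by rewrite ler0c exprn_ge0 ?ltW.
  have := nrmM (star x) x; rewrite nrm_star /= => H.
  rewrite -(ltr_pM2l (exprn_gt0 2 (mulr_gt0 (ltr0n R 2) nx))) mulrA -exprMn.
  rewrite divff ?gt_eqF ?mulr_gt0//; nra.
have [z [zs zz]] := sqrt_one_sub h hs h1.
have := pos z; rewrite zs zz linearB tr1 linearZ subr_ge0 => T1.
rewrite -lecR RRe_real ?realE ?normr_ge0//.
have rhs0 : 0 <= (2 * nrm x)%:C%C :> R[i] by rewrite ler0c mulr_ge0// nrm_ge0.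
rewrite -(ler_pXn2r (ltn0Sn 1)) ?nnegrE// sqr_normc mulrC.
apply: (@le_trans _ _ (tr (star x * x))); first by rewrite -subr_ge0; exact: sq.
have K0 : 0 < (k ^+ 2)%:C%C :> R[i] by rewrite (ltcR 0) exprn_gt0.
rewrite -(ler_pM2l K0); apply: (le_trans T1).
rewrite -rmorphXn -rmorphM -exprMn.
by rewrite mulVf ?expr1n// gt_eqF ?mulr_gt0.
Qed.

End Trace.

(** * Closures of traceless derivations *)

Section Graphs.
Context {R : realType} {A : cstarAlgType R[i]}.
Implicit Types (a b x y z u : A) (c : R[i]) (D : set A) (d : A -> A).

(** The rules of calculus that a graph T of pairs (x, delta x) must satisfy for
    winding numbers to make sense.  T is not required to be a function, so that
    it can be the closure of a graph before that closure is known to be one. *)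
Definition traceless_calculus (tr : A -> R[i]) (T : set (A * A)) : Prop :=
  [/\ T (1, 0),
      forall c x x' y y', T (x, x') -> T (y, y') -> T (c *: x + y, c *: x' + y'),
      forall x x' y y', T (x, x') -> T (y, y') -> T (x * y, x' * y + x * y') &
      forall x x', T (x, x') -> T (star x, star x')] /\
  (forall x x', T (x, x') -> tr x' = 0) /\
  (forall x (e : R), 0 < e -> exists z z', T (z, z') /\ nrm (z - x) < e).

Lemma op_closureP D d x x' : op_closure D d (x, x') <->
  forall e : R, 0 < e -> exists z, [/\ D z, nrm (x - z) < e & nrm (x' - d z) < e].
Proof.
split=> [H e e0|H].
  have e0' : 0 < e%:C%C :> R[i] by rewrite (ltcR 0).
  have [_ [[z Dz <-] [/= zx zx']]] := H _ (nbhsx_ballx (x, x') _ e0').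
  by exists z; split=> //; rewrite -ball_nrmE.
move=> B /nbhs_ballP[_ /gt0_complexP[e e0 ->] eB].
have [z [Dz z1 z2]] := H _ e0.
exists (z, d z); split; first by exists z.
by apply: eB; split => /=; rewrite ball_nrmE.
Qed.

Lemma graph_op_closure D d x : D x -> op_closure D d (x, d x).
Proof. by move=> Dx; apply: subset_closure; exists x. Qed.

Lemma dense_nrm D x (e : R) : closure D = setT -> 0 < e ->
  exists2 z, D z & nrm (z - x) < e.
Proof.
move=> Dd e0; have : closure D x by rewrite Dd.
have e0' : 0 < e%:C%C :> R[i] by rewrite (ltcR 0).
move=> /(_ _ (nbhsx_ballx x _ e0'))[z [Dz]]; rewrite ball_nrmE nrm_distC => ?.
by exists z.
Qed.

Lemma nrmM_close x y z t (e : R) : e <= 1 -> nrm (x - z) < e -> nrm (y - t) < e ->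
  nrm (x * y - z * t) <= e * (nrm x + nrm y + 1).
Proof.
move=> e1 h1 h2.
have -> : x * y - z * t = x * (y - t) + (x - z) * t.
  by rewrite mulrBr mulrBl addrA subrK.
have := nrmD (x * (y - t)) ((x - z) * t).
have := nrmM x (y - t); have := nrmM (x - z) t.
have : nrm t <= nrm y + e.
  have -> : t = y - (y - t) by rewrite opprB addrC subrK.
  by apply: (le_trans (nrmD _ _)); rewrite nrmN lerD2l ltW.
have := nrm_ge0 x; have := nrm_ge0 y; have := nrm_ge0 t.
have := nrm_ge0 (x - z); have := nrm_ge0 (y - t).
move: (nrm _) h1 => p h1; nra.
Qed.

(** A reformulation of membership in the closure that leaves the size of the
    constant free. *)
Lemma op_closure_approx D d x x' (K : R) : 0 <= K ->
  (forall e : R, 0 < e -> e <= 1 ->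
     exists z, [/\ D z, nrm (x - z) <= e * K & nrm (x' - d z) <= e * K]) ->
  op_closure D d (x, x').
Proof.
move=> K0 H; apply/op_closureP => e e0.
have K1 : 0 < K + 1 by rewrite ltr_wpDl.
have q0 : 0 < e / (K + 1) by rewrite divr_gt0.
have [||z [Dz z1 z2]] := H (Num.min 1 (e / (K + 1))).
- by rewrite lt_min ltr01 q0.
- by rewrite ge_min lexx.
suff lte : Num.min 1 (e / (K + 1)) * K < e.
  by exists z; split=> //; [apply: le_lt_trans z1 _|apply: le_lt_trans z2 _].
have : Num.min 1 (e / (K + 1)) <= e / (K + 1) by rewrite ge_min lexx orbT.
have : e / (K + 1) * (K + 1) = e by rewrite divfK// gt_eqF.
nra.
Qed.

Lemma star_derivation1 D d : star_derivation D d -> d 1 = 0.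
Proof.
move=> [[D1 _ _ _] _ dM _].
by apply: (addrI (d 1)); rewrite addr0 -{3}[1]mulr1 dM// mulr1 mul1r.
Qed.

Lemma closure_traceless_calculus (tr : {scalar A}) D d :
    faithful_tracial_state tr -> star_derivation D d ->
    closure D = setT -> (forall x, D x -> tr (d x) = 0) ->
  traceless_calculus tr (op_closure D d).
Proof.
move=> htr sd Dd d0; have d1 := star_derivation1 _ _ sd.
have [[D1 DL DM DS] dL dM dS] := sd.
split; [split|split].
- by rewrite -d1; exact: graph_op_closure.
- move=> c x x' y y' /op_closureP Tx /op_closureP Ty.
  have c0 : 0 <= complex.Re `|c| by have := normr_ge0 c; rewrite lecE => /andP[].
  have est a b z t e : nrm (a - z) < e -> nrm (b - t) < e ->
      nrm (c *: a + b - (c *: z + t)) <= e * (complex.Re `|c| + 1).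
    move=> h1 h2; rewrite opprD addrACA -scalerBr.
    apply: (le_trans (nrmD _ _)); rewrite nrmZ mulrDr mulr1 lerD ?(ltW h2)//.
    by rewrite mulrC ler_wpM2r// ltW.
  apply: (@op_closure_approx _ _ _ _ (complex.Re `|c| + 1)); first exact: addr_ge0.
  move=> e e0 _; have [z [Dz z1 z2]] := Tx _ e0; have [t [Dt t1 t2]] := Ty _ e0.
  by exists (c *: z + t); split; rewrite ?dL//; [exact: DL|exact: est|exact: est].
- move=> x x' y y' /op_closureP Tx /op_closureP Ty.
  have := nrm_ge0 x; have := nrm_ge0 y; have := nrm_ge0 x'; have := nrm_ge0 y'.
  move=> y'0 x'0 y0 x0.
  pose K := (nrm x + nrm y + 1) + (nrm x' + nrm y + 1) + (nrm x + nrm y' + 1).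
  apply: (@op_closure_approx _ _ _ _ K); first by rewrite !addr_ge0.
  move=> e e0 e1; have [z [Dz z1 z2]] := Tx _ e0; have [t [Dt t1 t2]] := Ty _ e0.
  exists (z * t); split; first exact: DM.
    by apply: (le_trans (nrmM_close _ _ _ _ _ e1 z1 t1)); rewrite ler_wpM2l ?ltW// /K; lra.
  rewrite dM// opprD addrACA; apply: (le_trans (nrmD _ _)).
  apply: (le_trans (lerD (nrmM_close _ _ _ _ _ e1 z2 t1) (nrmM_close _ _ _ _ _ e1 z1 t2))).
  by rewrite -mulrDr ler_wpM2l ?ltW// /K; lra.
- move=> x x' /op_closureP Tx; apply/op_closureP => e /Tx[z [Dz z1 z2]].
  exists (star z); split; first exact: DS.
    by rewrite -starN -starD nrm_star.
  by rewrite dS// -starN -starD nrm_star.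
- move=> x x' /op_closureP Tx.
  apply: norm_le_small => e e0.
  have e20 : 0 < e / 2 by rewrite divr_gt0.
  have [z [Dz _ z2]] := Tx _ e20.
  have -> : tr x' = tr (x' - d z) by rewrite linearB d0// subr0.
  by apply: (le_trans (tr_bound htr _)); rewrite -ler_pdivlMl// mulrC ltW.
- move=> x e e0; have [z Dz zx] := dense_nrm D x e Dd e0.
  by exists z, (d z); split=> //; exact: graph_op_closure.
Qed.

End Graphs.

(** * A norm on matrices and the Neumann series *)

Section Matrices.
Context {R : realType} {A : cstarAlgType R[i]} {p : nat}.
Implicit Types (X Y Z W : 'M[A]_p.+1).

(** The sum of the norms of the entries is not the C*-norm of M_p(A), but it is
    submultiplicative and defines the same topology. *)
Definition mxnrm X : R := \sum_i \sum_j nrm (X i j).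

Lemma mxnrm_ge0 X : 0 <= mxnrm X.
Proof. by apply: sumr_ge0 => i _; apply: sumr_ge0 => j _; exact: nrm_ge0. Qed.

Lemma nrm_entry X i j : nrm (X i j) <= mxnrm X.
Proof.
rewrite /mxnrm (bigD1 i)//= (bigD1 j)//= -addrA lerDl addr_ge0//.
  by apply: sumr_ge0 => k _; exact: nrm_ge0.
by apply: sumr_ge0 => k _; apply: sumr_ge0 => l _; exact: nrm_ge0.
Qed.

Lemma mxnrm0 : mxnrm 0 = 0.
Proof. by apply: big1 => i _; apply: big1 => j _; rewrite mxE nrm0. Qed.

Lemma mxnrmD X Y : mxnrm (X + Y) <= mxnrm X + mxnrm Y.
Proof.
rewrite /mxnrm -big_split/=; apply: ler_sum => i _.
by rewrite -big_split/=; apply: ler_sum => j _; rewrite mxE nrmD.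
Qed.

Lemma mxnrmN X : mxnrm (- X) = mxnrm X.
Proof.
by apply: eq_bigr => i _; apply: eq_bigr => j _; rewrite mxE nrmN.
Qed.

Lemma mxnrm_distC X Y : mxnrm (X - Y) = mxnrm (Y - X).
Proof. by rewrite -mxnrmN opprB. Qed.

Lemma nrm_sum (I : finType) (F : I -> A) : nrm (\sum_i F i) <= \sum_i nrm (F i).
Proof.
elim/big_ind2 : _ => [|a b c d h1 h2|//]; first by rewrite nrm0.
by apply: (le_trans (nrmD _ _)); rewrite lerD.
Qed.

Lemma mxnrmM X Y : mxnrm (X * Y) <= mxnrm X * mxnrm Y.
Proof.
rewrite /mxnrm mulr_suml; apply: ler_sum => i _.
apply: (@le_trans _ _ (\sum_j \sum_k nrm (X i k) * nrm (Y k j))).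
  apply: ler_sum => j _; rewrite mxE; apply: (le_trans (nrm_sum _ _)).
  by apply: ler_sum => k _; exact: nrmM.
rewrite exchange_big mulr_suml; apply: ler_sum => k _.
rewrite -mulr_sumr ler_wpM2l ?nrm_ge0// [leRHS](bigD1 k)/= // lerDl.
by apply: sumr_ge0 => l _; apply: sumr_ge0 => m _; exact: nrm_ge0.
Qed.

Lemma star_mxE X i j : star_mx X i j = star (X j i).
Proof. by rewrite !mxE. Qed.

Lemma star_sum (I : finType) (F : I -> A) : star (\sum_i F i) = \sum_i star (F i).
Proof. by apply: (big_morph _ (@starD _ A)); exact: star0. Qed.

Lemma mulrmx_entry X Y i j : (X * Y) i j = \sum_k X i k * Y k j.
Proof. by rewrite mxE. Qed.

Lemma star_mxM X Y : star_mx (X * Y) = star_mx Y * star_mx X.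
Proof.
apply/matrixP => i j; rewrite star_mxE !mulrmx_entry star_sum; apply: eq_bigr => k _.
by rewrite !star_mxE star_mul.
Qed.

Lemma star_mxB X Y : star_mx (X - Y) = star_mx X - star_mx Y.
Proof. by apply/matrixP => i j; rewrite !mxE starD starN. Qed.

Lemma star_mx1 : star_mx (1 : 'M[A]_p.+1) = 1.
Proof.
apply/matrixP => i j; rewrite star_mxE !mxE eq_sym.
by case: eqP => _; [exact: star1|exact: star0].
Qed.

Lemma mxnrm_star X : mxnrm (star_mx X) = mxnrm X.
Proof.
rewrite /mxnrm exchange_big; apply: eq_bigr => i _; apply: eq_bigr => j _.
by rewrite star_mxE nrm_star.
Qed.

Lemma mxnrmX Z n : mxnrm (Z ^+ n) <= mxnrm 1 * mxnrm Z ^+ n.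
Proof.
elim: n => [|n IH]; first by rewrite !expr0 mulr1.
rewrite !exprSr; apply: (le_trans (mxnrmM _ _)).
by rewrite mulrA ler_wpM2r ?mxnrm_ge0.
Qed.

Lemma mxnrm_small (e : R) : 0 < e ->
  exists2 d, 0 < d & forall X, (forall i j, nrm (X i j) < d) -> mxnrm X < e.
Proof.
move=> e0; exists (e / (p.+1 * p.+1)%:R) => [|X H]; first by rewrite divr_gt0.
have lt_row (F : 'I_p.+1 -> R) d : (forall i, F i < d) -> \sum_i F i < d * p.+1%:R.
  move=> Fd; rewrite mulr_natr -[p.+1 in ltRHS]card_ord -sumr_const.
  by apply: ltr_sum => //; apply/hasP; exists ord0; rewrite ?mem_index_enum.
have -> : e = e / (p.+1 * p.+1)%:R * p.+1%:R * p.+1%:R.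
  by rewrite -mulrA -natrM divfK.
by apply: (lt_row _ _) => i; exact: lt_row.
Qed.

(** The partial sums of the geometric series converge entrywise. *)
Lemma neumann Z : mxnrm Z < 1 -> exists Y, Y * (1 - Z) = 1 /\ (1 - Z) * Y = 1.
Proof.
move=> Z1; pose S n := \sum_(i < n) Z ^+ i.
have SL n : (1 - Z) * S n = 1 - Z ^+ n.
  by rewrite -opprB mulNr -subrX1 opprB.
have SR n : S n * (1 - Z) = 1 - Z ^+ n.
  rewrite -SL /S mulr_suml mulr_sumr; apply: eq_bigr => i _.
  by rewrite mulrBl mulrBr mul1r mulr1 -exprS -exprSr.
have cv i j : exists l, forall e, 0 < e ->
    exists k, forall n, (k <= n)%N -> nrm (S n i j - l) < e.
  apply: (@nrm_cauchy R A (fun n => S n i j) (mxnrm 1) (mxnrm Z)) => //.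
    exact: mxnrm_ge0.
  move=> n; rewrite /S big_ord_recr/= mxE addrAC subrr add0r.
  exact: (le_trans (nrm_entry _ _ _) (mxnrmX _ _)).
have [L LP] := choice (fun ij => cv ij.1 ij.2).
pose Y : 'M[A]_p.+1 := \matrix_(i, j) L (i, j).
have YP e : 0 < e -> exists n, mxnrm (S n - Y) < e /\ mxnrm (Z ^+ n) < e.
  move=> e0; have [d d0 dP] := mxnrm_small e e0.
  have [k kP] := choice (fun ij => LP ij d d0).
  have [l lP] := geometric_small (mxnrm 1) (mxnrm Z) e (mxnrm_ge0 _) Z1 e0.
  exists (maxn l (\max_ij k ij)); split; last first.
    by apply: (le_lt_trans (mxnrmX _ _)); apply: lP; exact: leq_maxl.
  apply: dP => i j; have := kP (i, j); rewrite !mxE /= => kij.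
  have := kij (maxn l (\max_ij k ij)); apply.
  by apply: leq_trans (leq_maxr _ _); exact: (leq_bigmax (i, j)).
have lim0 X : (forall e, 0 < e -> mxnrm X <= e) -> X = 0.
  move=> H; apply/matrixP => i j; rewrite mxE; apply: nrm_le_small => e /H.
  exact: le_trans (nrm_entry _ _ _).
have K0 : 0 < mxnrm (1 - Z) + 1 by rewrite ltr_wpDl ?mxnrm_ge0.
have bnd B C (e : R) : mxnrm B < e / (mxnrm (1 - Z) + 1) ->
    mxnrm C < e / (mxnrm (1 - Z) + 1) ->
    mxnrm (1 - Z) * mxnrm B + mxnrm C <= e.
  rewrite !ltr_pdivlMr// => h1 h2.
  have := mxnrm_ge0 (1 - Z); have := mxnrm_ge0 B; have := mxnrm_ge0 C.
  nra.
exists Y; split; apply/subr0_eq/lim0 => e e0.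
  have [n [h1 h2]] := YP _ (divr_gt0 e0 K0).
  have -> : Y * (1 - Z) - 1 = - ((S n - Y) * (1 - Z)) - Z ^+ n.
    by rewrite mulrBl SR opprB -addrA -opprD subrK.
  apply: (le_trans (mxnrmD _ _)); rewrite !mxnrmN.
  apply: (le_trans _ (bnd _ _ _ h1 h2)); rewrite lerD2r mulrC.
  by apply: (le_trans (mxnrmM _ _)); rewrite mulrC.
have [n [h1 h2]] := YP _ (divr_gt0 e0 K0).
have -> : (1 - Z) * Y - 1 = - ((1 - Z) * (S n - Y)) - Z ^+ n.
  by rewrite mulrBr SL opprB -addrA -opprD subrK.
apply: (le_trans (mxnrmD _ _)); rewrite !mxnrmN.
apply: (le_trans _ (bnd _ _ _ h1 h2)); rewrite lerD2r.
exact: mxnrmM.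
Qed.
End Matrices.

(** * The local winding of a unitary matrix *)

Section Winding.
Context {R : realType} {A : cstarAlgType R[i]} {p : nat}.
Context {tr : {scalar A}} (htr : faithful_tracial_state tr).
Context {T : set (A * A)} (hT : traceless_calculus tr T).
Implicit Types (X Y Z W Q : 'M[A]_p.+1).

Definition mxtr X : R[i] := tr (\tr X).

Definition mxgraph X X' : Prop := forall i j, T (X i j, X' i j).

Lemma mxtrD X Y : mxtr (X + Y) = mxtr X + mxtr Y.
Proof. by rewrite /mxtr !raddfD. Qed.

Lemma mxtrN X : mxtr (- X) = - mxtr X.
Proof. by rewrite /mxtr !raddfN. Qed.

Lemma mxtr0 : mxtr 0 = 0.
Proof. by rewrite /mxtr !raddf0. Qed.

Lemma mxtrC X Y : mxtr (X * Y) = mxtr (Y * X).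
Proof.
have [_ _ trC _] := htr.
have E (B C : 'M[A]_p.+1) : mxtr (B * C) = \sum_i \sum_k tr (B i k * C k i).
  rewrite /mxtr /mxtrace raddf_sum; apply: eq_bigr => i _.
  by rewrite mulrmx_entry raddf_sum.
rewrite !E exchange_big; apply: eq_bigr => i _; apply: eq_bigr => k _.
exact: trC.
Qed.

Lemma mxtr_bound X : complex.Re `|mxtr X| <= 2 * mxnrm X.
Proof.
apply: (le_trans (tr_bound htr _)); rewrite ler_pM2l//.
apply: (le_trans (nrm_sum _ _)); apply: ler_sum => i _.
by rewrite (bigD1 i)//= lerDl sumr_ge0// => j _; exact: nrm_ge0.
Qed.

Lemma graph0 : T (0, 0).
Proof.
have [[T1 TL TM TS] _] := hT.
by have := TL (-1) _ _ _ _ T1 T1; rewrite scaleN1r addNr scaler0 addr0.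
Qed.

Lemma graphZ c x x' : T (x, x') -> T (c *: x, c *: x').
Proof.
have [[_ TL _ _] _] := hT; move=> Tx.
by have := TL c _ _ _ _ Tx graph0; rewrite !addr0.
Qed.

Lemma graph_sum (I : finType) (F G : I -> A) : (forall i, T (F i, G i)) ->
  T (\sum_i F i, \sum_i G i).
Proof.
have [[T1 TL TM TS] _] := hT.
move=> H; elim/big_ind2 : _ => [|a b c d h1 h2|i _]; last exact: H.
  exact: graph0.
by have := TL 1 _ _ _ _ h1 h2; rewrite !scale1r.
Qed.

Lemma mxgraph1 : mxgraph 1 0.
Proof.
have [[T1 _ _ _] _] := hT; have T0 := graph0.
by move=> i j; rewrite !mxE; case: eqP.
Qed.

Lemma mxgraphB X X' Y Y' : mxgraph X X' -> mxgraph Y Y' -> mxgraph (X - Y) (X' - Y').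
Proof.
have [[T1 TL TM TS] _] := hT.
move=> TX TY i j; rewrite !mxE.
by have := TL (-1) _ _ _ _ (TY i j) (TX i j); rewrite !scaleN1r ![- _ + _]addrC.
Qed.

Lemma mxgraphM X X' Y Y' : mxgraph X X' -> mxgraph Y Y' ->
  mxgraph (X * Y) (X' * Y + X * Y').
Proof.
have [[T1 TL TM TS] _] := hT.
move=> TX TY i j; rewrite mulrmx_entry [X in (_, X)]mxE !mulrmx_entry -big_split/=.
by apply: graph_sum => k; exact: TM.
Qed.

Lemma mxgraph_star X X' : mxgraph X X' -> mxgraph (star_mx X) (star_mx X').
Proof.
have [[T1 TL TM TS] _] := hT.
by move=> TX i j; rewrite !star_mxE; exact: TS.
Qed.

Lemma mxtr_graph X X' : mxgraph X X' -> mxtr X' = 0.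
Proof.
have [_ [T0 _]] := hT.
move=> TX; rewrite /mxtr raddf_sum; apply: big1 => i _; exact: T0 (TX i i).
Qed.

Lemma mxgraph_dense W (e : R) : 0 < e ->
  exists X X', mxgraph X X' /\ mxnrm (X - W) < e.
Proof.
have [_ [_ Td]] := hT.
move=> e0; have [d d0 dP] := @mxnrm_small R A p e e0.
have [X XP] := choice (fun ij => Td (W ij.1 ij.2) d d0).
have [X' X'P] := choice XP.
exists (\matrix_(i, j) X (i, j)), (\matrix_(i, j) X' (i, j)); split.
  by move=> i j; rewrite !mxE; case: (X'P (i, j)).
by apply: dP => i j; rewrite !mxE; have [] := X'P (i, j).
Qed.

(** By cyclicity of the trace, Z^n Z' has the same trace as P / (n + 1), where P
    is the derivative of Z^(n+1), and the trace of P vanishes.  The induction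
    needs the factor Z^a to move the powers past the trace. *)
Lemma mxtr_pow_diff Z Z' n : mxgraph Z Z' -> mxtr (Z ^+ n * Z') = 0.
Proof.
move=> TZ.
suff [P [TP PE]] : exists P, mxgraph (Z ^+ n.+1) P /\
    forall a, mxtr (Z ^+ a * P) = mxtr (Z ^+ (a + n) * Z') *+ n.+1.
  have := PE 0; rewrite expr0 mul1r add0n (mxtr_graph _ _ TP) => /esym/eqP.
  by rewrite mulrn_eq0 => /eqP.
elim: n => [|n [P [TP PE]]].
  by exists Z'; split => // a; rewrite addn0 mulr1n.
exists (P * Z + Z ^+ n.+1 * Z'); split; first by rewrite exprSr; exact: mxgraphM.
move=> a; rewrite mulrDr mxtrD !mulrA mxtrC mulrA -exprS PE -exprD addSnnS.
by rewrite -mulrSr.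
Qed.

(** This is the vanishing of Tr ((1 - Z)^-1 delta(Z)): all the terms of the
    geometric series have trace zero by [mxtr_pow_diff], and the remainder tends
    to zero. *)
Lemma mxtr_neumann_diff Z Z' Y : mxgraph Z Z' -> mxnrm Z < 1 ->
  Y * (1 - Z) = 1 -> mxtr (Y * Z') = 0.
Proof.
move=> TZ Z1 YZ.
have tail n : mxtr (Y * Z') = mxtr (Y * Z ^+ n * Z').
  have hY : Y = \sum_(i < n) Z ^+ i + Y * Z ^+ n.
    have := congr1 (fun M => M * \sum_(i < n) Z ^+ i) YZ.
    rewrite /= -mulrA mul1r => <-.
    have -> : (1 - Z) * (\sum_(i < n) Z ^+ i) = 1 - Z ^+ n.
      by rewrite -opprB mulNr -subrX1 opprB.
    by rewrite mulrBr mulr1 subrK.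
  rewrite {1}hY mulrDl mxtrD mulr_suml (big_morph _ mxtrD mxtr0) big1 ?add0r// => i _.
  exact: mxtr_pow_diff.
apply: norm_le_small => e e0.
pose K := 2 * (mxnrm Y * mxnrm (1 : 'M[A]_p.+1) * mxnrm Z').
have [k kP] := geometric_small K _ e (mxnrm_ge0 Z) Z1 e0.
apply: le_trans (ltW (kP k (leqnn k))).
rewrite (tail k) (le_trans (mxtr_bound _))// -[leRHS]mulrA ler_pM2l//.
rewrite [leRHS]mulrAC (le_trans (mxnrmM _ _))// ler_wpM2r ?mxnrm_ge0//.
by rewrite (le_trans (mxnrmM _ _))// -mulrA ler_wpM2l ?mxnrm_ge0// mxnrmX.
Qed.

(** A unitary W need not be differentiable; its winding c is read off from the
    differentiable X nearby, with Q the inverse of X. *)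
Definition local_winding W (c : R[i]) : Prop :=
  exists2 e : R, 0 < e & forall X X' Q, mxgraph X X' -> mxnrm (X - W) < e ->
    Q * X = 1 -> X * Q = 1 -> mxtr (Q * X') = c.

Lemma local_winding_open W c : local_winding W c ->
  exists2 e : R, 0 < e & forall W', mxnrm (W - W') < e -> local_winding W' c.
Proof.
move=> [e e0 H]; have e20 : 0 < e / 2 by rewrite divr_gt0.
exists (e / 2) => // W' WW'; exists (e / 2) => // X X' Q TX XW'; apply: H => //.
have -> : X - W = (X - W') + (W' - W) by rewrite addrA subrK.
apply: (le_lt_trans (mxnrmD _ _)); rewrite (mxnrm_distC W').
by rewrite [e]splitr ltrD.
Qed.

(** The radius 1 / (2 |W| + 2) makes |X^* Y - W^* W| < 1. *)
Lemma near_unitary W : unitary_mx W -> exists2 e : R, 0 < e &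
  forall X Y, mxnrm (X - W) < e -> mxnrm (Y - W) < e ->
    mxnrm (1 - star_mx X * Y) < 1 /\ mxnrm (1 - X * star_mx Y) < 1.
Proof.
move=> [W1 W2]; pose K := mxnrm W.
(* The product of square matrices, restated as a ring product. *)
have {}W1 : star_mx W * W = 1 := W1.
have {}W2 : W * star_mx W = 1 := W2.
have K0 : 0 <= K := mxnrm_ge0 W.
have e0 : 0 < (2 * K + 2)^-1 by rewrite invr_gt0; lra.
exists (2 * K + 2)^-1 => // X Y; set e := (2 * K + 2)^-1 => XW YW.
have eK : e * (2 * K + 2) = 1 by rewrite mulVf// gt_eqF//; lra.
have prod_close (B C V V' : 'M[A]_p.+1) : V * V' = 1 -> mxnrm V = K -> mxnrm V' = K ->
    mxnrm (B - V) < e -> mxnrm (C - V') < e -> mxnrm (1 - B * C) < 1.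
  move=> V1 VK VK' BV CV.
  have -> : 1 - B * C = - ((B - V) * C) - V * (C - V').
    by rewrite mulrBr V1 mulrBl !opprB [RHS]addrC addrA subrK.
  have := mxnrmD (- ((B - V) * C)) (- (V * (C - V'))); rewrite !mxnrmN.
  have := mxnrmM (B - V) C; have := mxnrmM V (C - V').
  have : mxnrm C <= K + e.
    have -> : C = (C - V') + V' by rewrite subrK.
    by have := mxnrmD (C - V') V'; rewrite VK'; lra.
  have := mxnrm_ge0 (B - V); have := mxnrm_ge0 (C - V'); have := mxnrm_ge0 C.
  rewrite VK; nra.
have sK : mxnrm (star_mx W) = K := mxnrm_star W.
split; [apply: (prod_close _ _ _ _ W1)|apply: (prod_close _ _ _ _ W2)] => //;
  by rewrite -star_mxB mxnrm_star.
Qed.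

(** If X^* X and X X^* are invertible then X has a left and a right inverse. *)
Lemma quasi_unitary_inv X : mxnrm (1 - star_mx X * X) < 1 ->
  mxnrm (1 - X * star_mx X) < 1 -> exists Q, Q * X = 1 /\ X * Q = 1.
Proof.
move=> h1 h2.
have [P [P1 _]] := neumann _ h1; have [P' [_ P1']] := neumann _ h2.
rewrite !subKr in P1 P1'.
have E : P * star_mx X = star_mx X * P'.
  by rewrite -[LHS]mulr1 -P1' !mulrA -(mulrA P _ X) P1 mul1r.
exists (P * star_mx X); split; first by rewrite -mulrA.
by rewrite E mulrA.
Qed.

(** Fix a differentiable X0 near W.  For every differentiable X near W the
    product X0^* X is near 1, hence has winding zero, so that the winding of X is
    minus that of X0^*, whatever X is. *)
Lemma local_winding_exists W : unitary_mx W -> exists c, local_winding W c.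
Proof.
move=> /near_unitary[e e0 eP].
have [X0 [X0' [TX0 X0W]]] := mxgraph_dense W e e0.
have [h1 h2] := eP _ _ X0W X0W.
have [Q0 [_ Q02]] := quasi_unitary_inv _ h1 h2.
have Qs1 : star_mx Q0 * star_mx X0 = 1 by rewrite -star_mxM Q02 star_mx1.
exists (- mxtr (star_mx Q0 * star_mx X0')); exists e => // X X' Q TX XW QX XQ.
have [h _] := eP _ _ X0W XW.
have TZ : mxgraph (1 - star_mx X0 * X)
    (0 - (star_mx X0' * X + star_mx X0 * X')).
  by apply: (mxgraphB _ _ _ _ mxgraph1); apply: mxgraphM => //; exact: mxgraph_star.
have := mxtr_neumann_diff _ _ (Q * star_mx Q0) TZ h.
rewrite subKr -mulrA (mulrA (star_mx Q0)) Qs1 mul1r => /(_ QX).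
rewrite sub0r mulrN mxtrN !mulrDr mxtrD -!mulrA (mulrA (star_mx Q0) _ X') Qs1 mul1r.
rewrite (mxtrC Q (_ * _)) -!mulrA XQ mulr1 => /eqP.
by rewrite oppr_eq0 addrC addr_eq0 => /eqP.
Qed.

(** A differentiable W may be compared with itself, with inverse W^*. *)
Lemma local_winding_eq W X' c : unitary_mx W -> mxgraph W X' ->
  local_winding W c -> c = mxtr (star_mx W * X').
Proof.
move=> [W1 W2] TW [e e0 H]; apply/esym/H => //.
by rewrite subrr mxnrm0.
Qed.

Lemma local_winding_uniq W c c' : unitary_mx W ->
  local_winding W c -> local_winding W c' -> c = c'.
Proof.
move=> /near_unitary[e e0 eP] [e1 e10 H1] [e2 e20 H2].
have m0 : 0 < Num.min e (Num.min e1 e2) by rewrite !lt_min e0 e10.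
have [X [X' [TX]]] := mxgraph_dense W _ m0.
rewrite !lt_min => /and3P[XW XW1 XW2].
have [h1 h2] := eP _ _ XW XW.
have [Q [QX XQ]] := quasi_unitary_inv _ h1 h2.
by rewrite -(H1 X X' Q) -?(H2 X X' Q).
Qed.

End Winding.

(** * Invariance under homotopy and on K_1 *)

Section Homotopy.
Context {R : realType} {A : cstarAlgType R[i]}.
Context {tr : {scalar A}} (htr : faithful_tracial_state tr).
Context {T : set (A * A)} (hT : traceless_calculus tr T).

Lemma nbhs_mxnrm {p : nat} (M : 'M[A]_p.+1) (e : R) : 0 < e ->
  nbhs M [set N | mxnrm (M - N) < e].
Proof.
move=> e0; have [d d0 dP] := @mxnrm_small R A p e e0.
have d0' : 0 < d%:C%C :> R[i] by rewrite (ltcR 0).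
apply: (filterS _ (nbhsx_ballx M _ d0')) => N MN /=.
by apply: dP => i j; rewrite !mxE -ball_nrmE; case: MN => _; exact.
Qed.

(** The sets of times at which the winding takes a given value are open in
    [0, 1], by [local_winding_open], and partition this connected set. *)
Lemma homotopy_winding {p : nat} (M N M' N' : 'M[A]_p.+1) :
  unitary_homotopic M N -> mxgraph (T := T) M M' -> mxgraph (T := T) N N' ->
  mxtr (tr := tr) (star_mx M * M') = mxtr (tr := tr) (star_mx N * N').
Proof.
move=> [w [/subspace_continuousP wc wu w0 w1]] TM TN.
pose I := [set` `[0%R, 1%R]] : set R.
pose LW (S : set R[i]) : set R :=
  [set t | I t /\ exists2 c, S c & local_winding (tr := tr) (T := T) (w t) c].
have LWopen S : exists2 C, open C & LW S = I `&` C.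
  exists (interior [set t | I t -> LW S t]); first exact: open_interior.
  apply/seteqP; split=> t; last by case=> It /interior_subset; apply.
  move=> [It [c Sc wt]]; split=> //.
  have [e e0 eP] := local_winding_open _ _ wt.
  have near_t := wc t It _ (nbhs_mxnrm (w t) e e0).
  apply: (@filterS _ (nbhs t) _ _ _ _ near_t) => s /= H Is; split=> //.
  by exists c => //; apply: eP; exact: H.
have I0 : I 0 by rewrite /I /= in_itv /= lexx ler01.
have I1 : I 1 by rewrite /I /= in_itv /= lexx ler01.
have u0 : unitary_mx (w 0) := wu 0 I0.
have u1 : unitary_mx (w 1) := wu 1 I1.
have [c0 c0P] := local_winding_exists htr hT _ u0.
have LE : LW [set c0] = I.
  apply: (@segment_connected R 0 1).
  - by exists 0; split=> //; exists c0.
  - exact: LWopen.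
  (* The other values also form an open set, so that LW [set c0] is closed. *)
  have [C oC CE] := LWopen [set c | c <> c0].
  exists (~` C); first exact: open_closedC.
  apply/seteqP; split=> t [It].
    move=> [_ -> wt]; split=> // Ct.
    have [_ [c cc0 wt']] : LW [set c | c <> c0] t by rewrite CE.
    by apply: cc0; apply: local_winding_uniq wt' wt => //; exact: wu.
  move=> nC; split=> //; have [c wt] := local_winding_exists htr hT _ (wu t It).
  exists c0 => //; have [<- //|/eqP cc0] := eqVneq c c0.
  by exfalso; apply: nC; suff [] : (I `&` C) t by []; rewrite -CE; split=> //; exists c.
have [_ [_ -> c1P]] : LW [set c0] 1 by rewrite LE.
rewrite w0 in c0P u0; rewrite w1 in c1P u1.
by rewrite -(local_winding_eq _ _ _ u0 TM c0P) -(local_winding_eq _ _ _ u1 TN c1P).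
Qed.

Lemma star_scalar_mx {n : nat} (u : A) :
  star_mx (u%:M : 'M[A]_n) = (star u)%:M.
Proof.
apply/matrixP => i j; rewrite !mxE eq_sym.
by case: eqP => _; rewrite /= ?star0.
Qed.

Lemma star_stab_mx {k : nat} (u : A) :
  star_mx (stab_mx k (u%:M : 'M[A]_1)) = stab_mx k ((star u)%:M : 'M[A]_1).
Proof.
rewrite /star_mx /stab_mx map_block_mx tr_block_mx.
by congr block_mx; apply/matrixP => i j; rewrite !mxE ?star0// eq_sym;
  case: eqP => _; rewrite ?star0 ?star1.
Qed.

Lemma unitary_stab_mx {k : nat} (u : A) : unitary u ->
  unitary_mx (stab_mx k (u%:M : 'M[A]_1)).
Proof.
move=> [u1 u2]; rewrite /unitary_mx star_stab_mx /stab_mx !mulmx_block.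
rewrite !mulmx0 !mul0mx !mulmx1 ?mul1mx !addr0 !add0r -!scalar_mxM.
by rewrite [star u * u]u1 [u * star u]u2 -scalar_mx_block.
Qed.

Lemma K1_equiv_refl (u : A) : unitary u ->
  K1_equiv (u%:M : 'M[A]_1) (u%:M : 'M[A]_1).
Proof.
move=> uu; exists 0%N, 0%N, erefl; rewrite castmx_id.
exists (fun=> stab_mx 0 u%:M); split=> //.
  by apply: continuous_subspaceT => x; exact: cvg_cst.
by move=> t _; exact: unitary_stab_mx.
Qed.

(** The derivative of u (+) 1_k when u' is that of u. *)
Definition stab_diff (k : nat) (u' : A) : 'M[A]_k.+1 :=
  block_mx (u'%:M : 'M[A]_1) 0 0 (0 : 'M[A]_k).

Lemma mxtr_stab (k : nat) (u u' : A) :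
  mxtr (tr := tr) ((star_mx (stab_mx k (u%:M : 'M[A]_1)) : 'M[A]_k.+1) * stab_diff k u')
  = tr (star u * u').
Proof.
have E : stab_mx k ((star u)%:M : 'M[A]_1) *m
      block_mx (u'%:M : 'M[A]_1) 0 0 (0 : 'M[A]_k) =
    block_mx (star u * u')%:M 0 0 0.
  by rewrite /stab_mx mulmx_block !mulmx0 !mul0mx !addr0 -scalar_mxM.
rewrite star_stab_mx; apply: (congr1 tr); apply: (etrans (congr1 mxtrace E)).
by rewrite mxtrace_block mxtrace_scalar raddf0 addr0.
Qed.

Lemma mxgraph_stab (k : nat) (u u' : A) : T (u, u') ->
  mxgraph (T := T) (stab_mx k (u%:M : 'M[A]_1) : 'M[A]_k.+1) (stab_diff k u').
Proof.
have [[T1 _ _ _] _] := hT.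
have T0 := graph0 hT.
move=> Tu i j; rewrite /stab_mx /stab_diff !mxE.
by case: splitP => a _; rewrite !mxE; case: splitP => b _; rewrite !mxE //; case: eqP.
Qed.

(** Equal classes are stably homotopic because the class of v contains v. *)
Lemma K1_winding (u v u' v' : A) : unitary u -> unitary v ->
  T (u, u') -> T (v, v') -> K1_class1 u = K1_class1 v ->
  tr (star u * u') = tr (star v * v').
Proof.
move=> uu uv Tu Tv cls.
have : K1_class1 v (existT _ 1%N (v%:M : 'M[A]_1)).
  split; last exact: K1_equiv_refl.
  have [v1 v2] := uv; split; rewrite /= star_scalar_mx -scalar_mxM.
    by rewrite [star v * v]v1.
  by rewrite [v * star v]v2.
rewrite -cls => -[_ /= [k [l [e]]]].
have kl : k = l by apply: (@addnI 1%N).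
subst l; rewrite (eq_irrelevance e erefl) castmx_id => H.
rewrite -(mxtr_stab k u u') -(mxtr_stab k v v').
by apply: homotopy_winding => //; exact: mxgraph_stab.
Qed.

End Homotopy.

(** * Monomials in the generators *)

Section Powers.
Context {R : realType} {A : cstarAlgType R[i]}.
Implicit Types (x y u U V : A).

Lemma unitary_star u : unitary u -> unitary (star u).
Proof. by move=> [u1 u2]; split; rewrite starK. Qed.

Lemma unitaryM u v : unitary u -> unitary v -> unitary (u * v).
Proof.
move=> [u1 u2] [v1 v2]; split; rewrite star_mul !mulrA.
  by rewrite -(mulrA (star v)) u1 mulr1.
by rewrite -(mulrA u) v2 mulr1.
Qed.

Lemma upowSr u (k : int) : unitary u -> upow u (k + 1) = upow u k * u.
Proof.
move=> [u1 u2]; case: k => [k|[|k]].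
- by rewrite addrC -intS /= exprSr.
- by rewrite /= expr1 u1.
have -> : Negz k.+1 + 1 = Negz k.
  by rewrite !NegzE (intS k.+1) opprD addrC addrA subrr add0r.
by rewrite /= [in RHS]exprSr -mulrA u1 mulr1.
Qed.

Lemma upowBr u (k : int) : unitary u -> upow u (k - 1) = upow u k * star u.
Proof.
move=> uu; rewrite -[in RHS](subrK 1 k) upowSr// -mulrA.
by case: uu => _ ->; rewrite mulr1.
Qed.

Lemma upowD u (k l : int) : unitary u -> upow u (k + l) = upow u k * upow u l.
Proof.
move=> uu; elim/int_rect: l => [|n IH|n IH].
- by rewrite addr0 /= expr0 mulr1.
- by rewrite intS (addrC 1) addrA !upowSr// IH mulrA.
- by rewrite intS (addrC 1) opprD addrA !upowBr// IH mulrA.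
Qed.

Lemma unitary_upow u (k : int) : unitary u -> unitary (upow u k).
Proof.
have uX (v : A) n : unitary v -> unitary (v ^+ n).
  move=> vv; elim: n => [|n IH]; last by rewrite exprS; exact: unitaryM.
  by rewrite expr0; split; rewrite star1 mulr1.
by move=> uu; case: k => k /=; apply: uX => //; exact: unitary_star.
Qed.

Lemma star_upow u (k : int) : unitary u -> star (upow u k) = upow u (- k).
Proof.
move=> uu; have [h _] := unitary_upow u k uu.
have E : upow u k * upow u (- k) = 1 by rewrite -upowD// subrr.
by rewrite -[LHS]mulr1 -E mulrA h mul1r.
Qed.

(** Commutation up to a scalar.  The scalar is left existential because reordering
    the factors of a monomial is done up to linear span. *)
Definition qcomm x y := exists c : R[i], y * x = c *: (x * y).

Lemma qcomm_expl x y n : qcomm x y -> qcomm (x ^+ n) y.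
Proof.
move=> [c xy]; elim: n => [|n [d IH]].
  by exists 1; rewrite expr0 mulr1 mul1r scale1r.
exists (d * c); rewrite exprSr mulrA IH -scalerAl -(mulrA _ y x) xy -scalerAr mulrA.
by rewrite scalerA.
Qed.

Lemma qcomm_expr x y n : qcomm x y -> qcomm x (y ^+ n).
Proof.
move=> [c xy]; elim: n => [|n [d IH]].
  by exists 1; rewrite expr0 mulr1 mul1r scale1r.
exists (d * c); rewrite exprS -(mulrA y _ x) IH -scalerAr (mulrA y x) xy -scalerAl -mulrA.
by rewrite scalerA.
Qed.

Lemma rotation_qcomm (theta : R) U V (k l : int) : rotation_relation theta U V ->
  qcomm (upow U k) (upow V l).
Proof.
move=> [[U1 U2] [V1 V2]]; set c := rot_scalar theta => UV.
have c0 : c != 0.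
  apply/eqP => c0; have : star V * (star U * (U * V)) = 1.
    by rewrite (mulrA _ U) U1 mul1r V1.
  by rewrite UV c0 scale0r !mulr0 => /esym/eqP; rewrite oner_eq0.
have q1 : qcomm U V by exists c^-1; rewrite UV scalerA mulVf// scale1r.
have q2 : qcomm (star U) V.
  exists c; rewrite -[LHS]mul1r -U1 !mulrA -(mulrA (star U)) UV.
  by rewrite -scalerAr -scalerAl -!mulrA U2 mulr1.
have q3 : qcomm U (star V).
  exists c; rewrite -[LHS]mulr1 -V2 !mulrA -(mulrA _ U) UV.
  by rewrite -scalerAr -scalerAl !mulrA V1 mul1r.
have q4 : qcomm (star U) (star V).
  by exists c^*; rewrite -star_mul UV starZ star_mul.
by case: k => k; case: l => l; apply: qcomm_expl; apply: qcomm_expr.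
Qed.

(** The linear span of the monomials U^k V^l, built one term at a time so that
    its induction principle is linearity. *)
Inductive torus_span U V : A -> Prop :=
| torus_span0 : torus_span U V 0
| torus_spanZD (c : R[i]) (k l : int) x : torus_span U V x ->
    torus_span U V (c *: (upow U k * upow V l) + x).

Section Span.
Context {theta : R} {U V : A} (rUV : rotation_relation theta U V).
Notation S := (torus_span U V).

Let uU : unitary U := let: And3 h _ _ := rUV in h.
Let uV : unitary V := let: And3 _ h _ := rUV in h.

Lemma torus_span_linear (c : R[i]) x y : S x -> S y -> S (c *: x + y).
Proof.
move=> Sx Sy; elim: Sx => [|d k l z _ IH]; first by rewrite scaler0 add0r.
by rewrite scalerDr scalerA -addrA; exact: torus_spanZD.
Qed.

Lemma torus_spanM x y : S x -> S y -> S (x * y).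
Proof.
move=> Sx Sy; elim: Sx => [|d k l z _ IH]; first by rewrite mul0r; exact: torus_span0.
rewrite mulrDl -scalerAl; apply: torus_span_linear => //.
elim: Sy => [|e m n t _ IHt]; first by rewrite mulr0; exact: torus_span0.
rewrite mulrDr -scalerAr; apply: torus_span_linear => //.
have [f fE] := rotation_qcomm theta U V m l rUV.
rewrite mulrA -(mulrA (upow U k)) fE -scalerAr -scalerAl !mulrA -upowD//.
rewrite -mulrA -upowD// -[_ *: _]addr0; apply: torus_spanZD; exact: torus_span0.
Qed.

Lemma torus_span_monomial k l : S (upow U k * upow V l).
Proof.
by rewrite -[_ * _]scale1r -[_ *: _]addr0; apply: torus_spanZD; exact: torus_span0.
Qed.

Lemma torus_span_star x : S x -> S (star x).
Proof.
elim=> [|c k l y _ IH]; first by rewrite star0; exact: torus_span0.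
rewrite starD starZ; apply: torus_span_linear => //.
rewrite star_mul !star_upow//.
have [f ->] := rotation_qcomm theta U V (- k) (- l) rUV.
by rewrite -[_ *: _]addr0; apply: torus_spanZD; exact: torus_span0.
Qed.

(** By the commutation relation, the span of the monomials is already a
    *-subalgebra. *)
Lemma star_alg_torus_span x : star_alg U V x -> S x.
Proof.
apply; split=> [|y]; last first.
  move=> [->|->].
    by have := torus_span_monomial 1 0; rewrite /= expr1 expr0 mulr1.
  by have := torus_span_monomial 0 1; rewrite /= expr1 expr0 mul1r.
split.
- by have := torus_span_monomial 0 0; rewrite /= !expr0 mulr1.
- exact: torus_span_linear.
- exact: torus_spanM.
- exact: torus_span_star.
Qed.

End Span.
End Powers.

(** * Derivations and Fourier coefficients *)

Section Derivations.
Context {R : realType} {A : cstarAlgType R[i]}.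
Implicit Types (x y u : A) (a b c : R[i]).

Lemma derivation_upow (D : set A) (d : A -> A) u a (k : int) :
  star_derivation D d -> D u -> d u = a *: u -> a^* = - a ->
  D (upow u k) /\ d (upow u k) = (k%:~R * a) *: upow u k.
Proof.
move=> sd; have d1 := star_derivation1 _ _ sd; case: sd => [[D1 DL DM DS] dL dM dS].
have dX x e n : D x -> d x = e *: x -> D (x ^+ n) /\ d (x ^+ n) = (n%:R * e) *: x ^+ n.
  move=> Dx dx; elim: n => [|n [Dn dn]]; first by rewrite expr0 mul0r scale0r.
  rewrite exprS; split; first exact: DM.
  by rewrite dM// dx dn -scalerAl -scalerAr -scalerDl -[n.+1]add1n natrD mulrDl mul1r.
move=> Du du aN; case: k => k; first by have := dX u a k Du du.
have := dX (star u) (- a) k.+1 (DS _ Du); rewrite dS// du starZ aN => /(_ erefl).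
by rewrite NegzE mulrNz mulNr mulrN.
Qed.

Section Rotation.
Context {theta : R} {U V : A} (rUV : rotation_relation theta U V).
Context (dense : closure (star_alg U V) = setT).
Context {tr : {scalar A}} (ctr : canonical_trace U V tr).

Let uU : unitary U := let: And3 h _ _ := rUV in h.
Let uV : unitary V := let: And3 _ h _ := rUV in h.
Let htr : faithful_tracial_state tr := ctr.1.
Let W k l := upow U k * upow V l.

(** U^m V^(n-l) U^(-k) has the trace of U^(m-k) V^(n-l), by cyclicity. *)
Lemma monomial_orthonormal (k l m n : int) :
  tr (W m n * star (W k l)) = ((m == k) && (n == l))%:R.
Proof.
have [_ _ trC _] := htr.
rewrite /W star_mul !star_upow// mulrA -(mulrA (upow U m)) -upowD// trC mulrA.
by rewrite -upowD// ctr.2 addrC !subr_eq0.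
Qed.

(** Such an x is orthogonal to all the polynomials in U and V, hence, by density
    and boundedness of tr, to itself. *)
Lemma fourier_inj x : (forall k l, tr (x * star (W k l)) = 0) -> x = 0.
Proof.
have [_ _ _ faith] := htr => x0.
have xS z : torus_span U V z -> tr (x * star z) = 0.
  elim=> [|c k l y _ IH]; first by rewrite star0 mulr0 linear0.
  by rewrite starD starZ mulrDr -scalerAr linearD linearZ /= IH x0 mulr0 addr0.
suff xx : tr (star (star x) * star x) = 0.
  by rewrite -[x]starK (faith _ xx) star0.
rewrite starK; apply: norm_le_small => e e0.
have K0 : 0 < 2 * nrm x + 1 by rewrite ltr_wpDl ?mulr_ge0 ?nrm_ge0.
have [z Dz zx] := dense_nrm _ x _ dense (divr_gt0 e0 K0).
have -> : tr (x * star x) = tr (x * star (x - z)).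
  rewrite starD starN mulrDr mulrN linearB (xS z) ?subr0//.
  exact: (star_alg_torus_span rUV).
apply: (le_trans (tr_bound htr _)).
have := nrmM x (star (x - z)); rewrite nrm_star nrm_distC.
rewrite ltr_pdivlMr// in zx.
have := nrm_ge0 x; have := nrm_ge0 (z - x); nra.
Qed.

(** Both canonical derivations are covered: (a, b) is (2 pi i, 0) for the first
    and (0, 2 pi i) for the second. *)
Section OneDerivation.
Context {d : A -> A} {a b : R[i]} (sd : star_derivation (star_alg U V) d).
Context (aN : a^* = - a) (bN : b^* = - b) (dU : d U = a *: U) (dV : d V = b *: V).
Let delta := op_closure (star_alg U V) d.

Lemma derivation_monomial (k l : int) : star_alg U V (W k l) /\
  d (W k l) = (k%:~R * a + l%:~R * b) *: W k l.
Proof.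
have DU : star_alg U V U by move=> S [_]; apply; left.
have DV : star_alg U V V by move=> S [_]; apply; right.
have [DUk dUk] := derivation_upow _ _ _ _ k sd DU dU aN.
have [DVl dVl] := derivation_upow _ _ _ _ l sd DV dV bN.
case: sd => [[_ _ DM _] _ dM _]; split; first exact: DM.
by rewrite dM// dUk dVl -scalerAl -scalerAr -scalerDl.
Qed.

(** The trace of d vanishes on monomials: the trace of a monomial other than 1
    is zero, and d 1 = 0. *)
Lemma delta_calculus : traceless_calculus tr delta.
Proof.
apply: closure_traceless_calculus => // x /(star_alg_torus_span rUV) Sx.
suff [] : star_alg U V x /\ tr (d x) = 0 by [].
have [[D1 DL _ _] dL _ _] := sd.
elim: Sx => [|c k l y _ [Dy IH]].
  have D0 : star_alg U V 0.
    by have := DL (-1) _ _ D1 D1; rewrite scaleN1r addNr.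
  split=> //; have := dL (-1) _ _ D1 D1.
  by rewrite !scaleN1r !addNr => ->; rewrite linear0.
have [DW dW] := derivation_monomial k l.
split; first exact: DL.
rewrite dL// dW linearD linearZ linearZ /= IH ctr.2 addr0.
by case: eqP => [->|_]; case: eqP => [->|_];
  rewrite /= ?mulr0// !mul0r addr0 !(mul0r, mulr0).
Qed.

Lemma delta_monomial (k l : int) :
  delta (W k l, (k%:~R * a + l%:~R * b) *: W k l).
Proof.
have [DW <-] := derivation_monomial k l; exact: graph_op_closure.
Qed.

(** Integration by parts: x (U^k V^l)^* has a derivative of trace zero. *)
Lemma delta_fourier x x' (k l : int) : delta (x, x') ->
  tr (x' * star (W k l)) = (k%:~R * a + l%:~R * b) * tr (x * star (W k l)).
Proof.
have [[_ _ TM TS] [T0 _]] := delta_calculus => Tx.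
have := T0 _ _ (TM _ _ _ _ Tx (TS _ _ (delta_monomial k l))).
rewrite starZ -scalerAr linearD linearZ /= => /eqP.
rewrite addr_eq0 => /eqP ->; rewrite -mulNr; congr (_ * _).
by rewrite rmorphD !rmorphM /= !rmorph_int aN bN !mulrN -opprD opprK.
Qed.

(** By [delta_fourier] the Fourier coefficients of delta(x) are determined by
    those of x; this is the closability of d. *)
Lemma delta_functional x y z : delta (x, y) -> delta (x, z) -> y = z.
Proof.
move=> xy xz; apply/subr0_eq/fourier_inj => k l.
by rewrite mulrBl linearB (delta_fourier _ _ _ _ xy) (delta_fourier _ _ _ _ xz) subrr.
Qed.

Lemma op_val_delta x y : delta (x, y) -> op_val delta x = y.
Proof.
move=> xy; apply: (delta_functional _ _ _ _ xy).
exact: (@xgetPex A 0 [set z | delta (x, z)] (ex_intro (fun z => delta (x, z)) y xy)).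
Qed.

Lemma delta_winding u u' (m n : int) : unitary u -> delta (u, u') ->
  K1_class1 u = K1_class1 (W m n) -> tr (star u * u') = m%:~R * a + n%:~R * b.
Proof.
move=> uu Tu cls.
have uW : unitary (W m n) by apply: unitaryM; exact: unitary_upow.
rewrite (K1_winding htr delta_calculus _ _ _ _ uu uW Tu (delta_monomial m n) cls).
have [_ tr1 _ _] := htr; case: uW => W1 _.
by rewrite -scalerAr linearZ /= W1 tr1 mulr1.
Qed.

End OneDerivation.
End Rotation.
End Derivations.

Lemma conj_two_pi_i (R : realType) : (two_pi_i : R[i])^* = - two_pi_i.
Proof. by rewrite /two_pi_i /Num.conj /=; simpc. Qed.

Lemma two_pi_i_neq0 (R : realType) : (two_pi_i : R[i]) != 0.
Proof.
rewrite /two_pi_i eq_complex /= negb_and; apply/orP; right.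
by rewrite mulf_neq0 ?gt_eqF ?pi_gt0.
Qed.

Theorem theorem2 (R : realType) (theta : R) (A : cstarAlgType R[i]) (U V : A)
    (tr : {scalar A}) (d1 d2 : A -> A) (m n : int) (u : A) :
  rotation_algebra theta U V ->
  canonical_trace U V tr ->
  star_derivation (star_alg U V) d1 ->
  d1 U = two_pi_i *: U -> d1 V = 0 ->
  star_derivation (star_alg U V) d2 ->
  d2 U = 0 -> d2 V = two_pi_i *: V ->
  unitary u ->
  let delta1 := op_closure (star_alg U V) d1 in
  let delta2 := op_closure (star_alg U V) d2 in
  let E := energy tr delta1 delta2 in
  let W := upow U m * upow V n in
  K1_class1 u = K1_class1 W ->
  (E W <= E u)%E /\ (E u = E W <-> exists c : R[i], u = c *: W).
Proof.
move=> [rUV dense _] ctr sd1 d1U d1V sd2 d2U d2V uu delta1 delta2 E W cls.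
have [uU uV _] := rUV; have htr := ctr.1; have [pos tr1 _ faith] := htr.
have iN := conj_two_pi_i R; have oN : (0 : R[i])^* = - 0 by rewrite oppr0 rmorph0.
have {}d1V : d1 V = 0 *: V by rewrite scale0r.
have {}d2U : d2 U = 0 *: U by rewrite scale0r.
have uW : unitary W by apply: unitaryM; exact: unitary_upow.
pose c1 : R[i] := m%:~R * two_pi_i; pose c2 : R[i] := n%:~R * two_pi_i.
have E1 (k l : int) : k%:~R * two_pi_i + l%:~R * 0 = k%:~R * two_pi_i :> R[i].
  by rewrite mulr0 addr0.
have E2 (k l : int) : k%:~R * 0 + l%:~R * two_pi_i = l%:~R * two_pi_i :> R[i].
  by rewrite mulr0 add0r.
have EE v y1 y2 : delta1 (v, y1) -> delta2 (v, y2) ->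
    E v = (2^-1 * complex.Re (tr (star y1 * y1 + star y2 * y2)))%:E.
  move=> v1 v2; rewrite /E /energy asboolT; last by split; [exists y1|exists y2].
  by rewrite (op_val_delta rUV dense ctr sd1 iN oN d1U d1V _ _ v1)
             (op_val_delta rUV dense ctr sd2 oN iN d2U d2V _ _ v2).
pose EW : R := 2^-1 * complex.Re (c1^* * c1 + c2^* * c2).
have Eeigen v : unitary v -> delta1 (v, c1 *: v) -> delta2 (v, c2 *: v) -> E v = EW%:E.
  move=> [v1 _] w1 w2; rewrite (EE _ _ _ w1 w2) !starZ -!scalerAl -!scalerAr v1.
  by rewrite linearD !linearZ /= tr1 !mulr1.
have W1 : delta1 (W, c1 *: W).
  by have := delta_monomial sd1 iN oN d1U d1V m n; rewrite E1.
have W2 : delta2 (W, c2 *: W).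
  by have := delta_monomial sd2 oN iN d2U d2V m n; rewrite E2.
have EWE : E W = EW%:E by exact: Eeigen.
have H1 := delta_calculus rUV dense ctr sd1 iN oN d1U d1V.
have H2 := delta_calculus rUV dense ctr sd2 oN iN d2U d2V.
have scal c : u = c *: W -> E u = E W.
  move=> uc; rewrite EWE; apply: Eeigen => //.
    by have := graphZ H1 c _ _ W1; rewrite uc scalerA mulrC -scalerA.
  by have := graphZ H2 c _ _ W2; rewrite uc scalerA mulrC -scalerA.
have [dom|ndom] := pselect (op_domain delta1 u /\ op_domain delta2 u); last first.
  have EU : E u = +oo%E by rewrite /E /energy asboolF.
  split; first by rewrite EU leey.
  split; first by rewrite EU EWE.
  by move=> [c uc]; exact: scal uc.
have [[y1 u1] [y2 u2]] := dom.
have t1 : tr (star u * y1) = c1.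
  by rewrite (delta_winding rUV dense ctr sd1 iN oN d1U d1V _ _ _ _ uu u1 cls) E1.
have t2 : tr (star u * y2) = c2.
  by rewrite (delta_winding rUV dense ctr sd2 oN iN d2U d2V _ _ _ _ uu u2 cls) E2.
have p1 := tr_var htr _ _ _ uu t1; have p2 := tr_var htr _ _ _ uu t2.
set z1 := y1 - c1 *: u in p1; set z2 := y2 - c2 *: u in p2.
have Eu : E u = (EW + 2^-1 * (complex.Re (tr (star z1 * z1))
                               + complex.Re (tr (star z2 * z2))))%:E.
  rewrite (EE _ _ _ u1 u2) p1 p2 /EW -mulrDr -!raddfD; congr (_ * complex.Re _)%:E.
  by rewrite linearD /=; ring.
have r1 : 0 <= complex.Re (tr (star z1 * z1)) by have := pos z1; rewrite lecE => /andP[].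
have r2 : 0 <= complex.Re (tr (star z2 * z2)) by have := pos z2; rewrite lecE => /andP[].
split; first by rewrite Eu EWE lee_fin lerDl mulr_ge0// ?invr_ge0// addr_ge0.
split; last by move=> [c uc]; exact: scal uc.
rewrite Eu EWE => -[] eqE.
have zero z : complex.Re (tr (star z * z)) = 0 -> z = 0.
  move=> z0; apply: faith; have := ger0_Im (pos z) => i0.
  by apply/eqP; rewrite eq_complex z0 i0 !eqxx.
have /subr0_eq y1E : z1 = 0 by apply: zero; lra.
have /subr0_eq y2E : z2 = 0 by apply: zero; lra.
pose f k l := tr (u * star (upow U k * upow V l)).
(* Comparing the coefficients of delta_j(u) and c_j u yields
   (m - k) f k l = 0 for j = 1 and (n - l) f k l = 0 for j = 2. *)
have supp k l : (m == k) && (n == l) = false -> f k l = 0.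
  move=> kl.
  have fZ c : tr (c *: u * star (upow U k * upow V l)) = c * f k l.
    by rewrite -scalerAl linearZ.
  have := delta_fourier rUV dense ctr sd1 iN oN d1U d1V _ _ k l u1.
  have := delta_fourier rUV dense ctr sd2 oN iN d2U d2V _ _ k l u2.
  rewrite E1 E2 y1E y2E !fZ -/(f k l) => /eqP h2 /eqP h1.
  rewrite -subr_eq0 in h1; rewrite -subr_eq0 in h2.
  apply/eqP; move: h1 h2 kl.
  rewrite -!mulrBl -!rmorphB !mulf_eq0 (negbTE (two_pi_i_neq0 R)) !orbF !intr_eq0.
  by rewrite !subr_eq0; case: (m == k) => //=; case: (n == l) => //=.
exists (f m n); apply/subr0_eq/(fourier_inj rUV dense ctr) => k l.
rewrite mulrBl linearB -scalerAl linearZ /= (monomial_orthonormal rUV ctr) -/(f k l).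
have [/andP[/eqP <- /eqP <-]|/negbTE kl] := boolP ((m == k) && (n == l)).
  by rewrite mulr1 subrr.
by rewrite supp// mulr0 subr0.
Qed.
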